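(* Algorithm Fast-Relax+List-Scheduling (described in the context), run with parameter $\varepsilon>0$, is a $(2+\varepsilon)$-approximation algorithm for preemptive scheduling with release dates on $m$ identical parallel machines under speed-scaling with an energy budget, both in the continuous-speed setting and in the discrete-speed setting: it outputs a feasible schedule using energy at most $E$ whose total weighted completion time $\sum_j w_jC_j$ is at most $(2+\varepsilon)$ times the optimum.
   Context: Jobs $j\in J=\{1,\dots,n\}$ have work volumes $v_j$, weights $w_j\ge 0$ and release dates $r_j\ge 0$; there are $m$ identical parallel machines and a total energy budget $E$. Power is $P(s)=s^{\alpha}$ with constant $\alpha>1$ (in the discrete setting speeds are restricted to a given finite set). A job $j$ with assigned energy $E_j$ running at constant speed on one of the machines has execution time $x_j=(v_j^{\alpha}/E_j)^{1/(\alpha-1)}$. A schedule assigns energies with $\sum_j E_j\le E$ and processes each job preemptively (not before $r_j$, at most one machine at a time per job, at most one job per machine at a time); the objective is $\sum_j w_jC_j$. Fast single machine relaxation: a single machine $m$ times as fast, on which energy $E_j$ yields execution time $x_j/m$, with all release dates set to $0$. Algorithm Fast-Relax+List-Scheduling: let $\varepsilon'=\varepsilon/2$, $X_L=\sum_j w_j(v_j^{\alpha}/E)^{1/(\alpha-1)}$ and $X_U=\frac{n\,\max_j w_j}{E^{1/(\alpha-1)}}\big(\sum_j v_j\big)^{\alpha/(\alpha-1)}$. For $i=0,\dots,\lceil\log_{1+\varepsilon'}(X_U/X_L)\rceil$ and $X=(1+\varepsilon')^i$: (1) compute, with a $(1+\varepsilon')$-approximation scheme for the fast single machine relaxation augmented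 with the constraint $\sum_j w_j\, m\, x^1_j\le X$ (where $x^1_j$ is the execution time on the fast machine), an energy assignment $E_j$ and a job order $\pi$ (skip $X$ if infeasible); (2) keeping these energies, apply preemptive list scheduling on the $m$ machines respecting release dates: at any time run the (at most) $m$ available (released, unfinished) jobs with highest priority in $\pi$; (3) keep the cheapest schedule found over all $i$.
   Formalization: The guesses are X = X_L(1+ε')^i instead of (1+ε')^i, and for discrete speeds X_L and X_U use the discrete execution times (least duration mixing speeds) instead of the power formulas; with the literal formulas every guess can be infeasible. *)

(* Defs.v *)
From HB Require Import structures.
From mathcomp Require Import all_boot all_order all_algebra all_fingroup.
From mathcomp Require Import all_classical all_reals all_analysis.

Set Implicit Arguments.
Unset Strict Implicit.
Unset Printing Implicit Defensive.

Import Order.TTheory GRing.Theory Num.Theory.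
Local Open Scope classical_set_scope.
Local Open Scope ring_scope.

(* A machine may run at any speed (Continuous) or only at the finitely many
   speeds [speed i] (Discrete). The power at speed s is s `^ alpha. *)
Inductive speed_model (R : realType) : Type :=
| Continuous
| Discrete (k : nat) (speed : 'I_k -> R).

Arguments Continuous {R}.
Arguments Discrete {R k} speed.

Record instance (R : realType) : Type := Instance {
  njobs : nat;
  nmach : nat;
  vol : 'I_njobs -> R;
  weight : 'I_njobs -> R;
  release : 'I_njobs -> R;
  budget : R;
  alpha : R;
  speeds : speed_model R }.

(* [t i] is the time spent at speed [speed i]; a job may change its speed while
   it is being processed. *)
Definition speed_profile (R : realType) (alpha : R) (k : nat)
    (speed : 'I_k -> R) (v e : R) (t : 'I_k -> R) : Prop :=
  [/\ forall i, 0 <= t i,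
      \sum_(i < k) speed i * t i = v
    & \sum_(i < k) speed i `^ alpha * t i <= e].

(* The energy e suffices to process the volume v. *)
Definition admits (R : realType) (alpha : R) (md : speed_model R) (v e : R)
    : Prop :=
  match md with
  | Continuous => 0 < e
  | Discrete k speed => exists t, @speed_profile R alpha k speed v e t
  end.

(* Execution time of volume v with energy e. Continuous speeds: running for x
   time units at the constant speed v / x uses the energy v^alpha / x^(alpha-1),
   which is solved for x. Discrete speeds: the least duration of an admissible
   profile, i.e. the value of a linear program with finitely many variables.
   Only meaningful if [admits alpha md v e]. *)
Definition exec_time (R : realType) (alpha : R) (md : speed_model R) (v e : R)
    : R :=
  match md with
  | Continuous => (v `^ alpha / e) `^ (alpha - 1)^-1
  | Discrete k speed =>
      inf [set \sum_(i < k) t i | t in @speed_profile R alpha k speed v e]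
  end.

Section Scheduling.
Variables (R : realType) (I : instance R).
Local Notation job := 'I_(njobs I).
Local Notation mach := 'I_(nmach I).

Definition total_vol : R := \sum_(j < njobs I) vol j.
Definition max_weight : R := \big[Num.max/0]_(j < njobs I) weight j.

(* The last condition says that the budget is large enough to finish all jobs;
   with continuous speeds it reads 0 < budget I. *)
Definition valid_instance : Prop :=
  [/\ (0 < nmach I)%N /\ 1 < alpha I,
      forall j : job, [/\ 0 < vol j, 0 <= weight j & 0 <= release j],
      (if speeds I is Discrete k speed then forall i, 0 <= speed i else True)
    & admits (alpha I) (speeds I) total_vol (budget I)].

Definition job_time (en : job -> R) (j : job) : R :=
  exec_time (alpha I) (speeds I) (vol j) (en j).

Definition energy_assignment (en : job -> R) : Prop :=
  (forall j, admits (alpha I) (speeds I) (vol j) (en j)) /\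
  \sum_(j < njobs I) en j <= budget I.

(* [run i t] is the job, if any, that machine i processes at time t; so there is
   at most one job per machine at a time, but preemption and migration are
   allowed. *)
Record schedule : Type := Schedule {
  energy : job -> R;
  run : mach -> R -> option job;
  run_measurable : forall i j,
    measurable ([set t | run i t = Some j] : set (measurableTypeR R));
  run_unique : forall t i i' j,
    run i t = Some j -> run i' t = Some j -> i = i' }.

Definition running (S : schedule) (t : R) (j : job) : bool :=
  [exists i, run S i t == Some j].

(* The amount of processing time that job j has received before time t. *)
Definition processed (S : schedule) (t : R) (j : job) : R :=
  fine (lebesgue_measure
          ([set u | u < t /\ running S u j] : set (measurableTypeR R))).

Definition feasible (S : schedule) : Prop :=
  [/\ energy_assignment (energy S),
      forall t j, running S t j -> release j <= t,
      forall t j, processed S t j <= job_time (energy S) j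
    & forall j, exists t, processed S t j = job_time (energy S) j].

Definition completion (S : schedule) (j : job) : R :=
  inf [set t | processed S t j = job_time (energy S) j].

Definition cost (S : schedule) : R :=
  \sum_(j < njobs I) weight j * completion S j.

Definition opt : R := inf [set cost S | S in feasible].

(* A solution of the fast single machine relaxation: energies, and an order pi
   in which pi j is the position of job j. Without release dates the machine
   processes the jobs in this order without idling. *)
Definition relax_solution : Type := ((job -> R) * {perm job})%type.

Definition fast_time (en : job -> R) (j : job) : R :=
  job_time en j / (nmach I)%:R.

(* The constraint bounds the sum of weight * (nmach * fast execution time). *)
Definition relax_feasible (X : R) (s : relax_solution) : Prop :=
  energy_assignment s.1 /\
  \sum_(j < njobs I) weight j * ((nmach I)%:R * fast_time s.1 j) <= X.

Definition relax_cost (s : relax_solution) : R :=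
  \sum_(j < njobs I)
    weight j * \sum_(k < njobs I | (s.2 k <= s.2 j)%N) fast_time s.1 k.

Definition relax_opt (X : R) : R :=
  inf [set relax_cost s | s in relax_feasible X].

(* [None] reports that no solution satisfies the constraint with bound X. *)
Definition relax_approx (rho : R) (solve : R -> option relax_solution) : Prop :=
  forall X, match solve X with
            | Some s => relax_feasible X s /\ relax_cost s <= rho * relax_opt X
            | None => forall s, ~ relax_feasible X s
            end.

(* Released and unfinished. *)
Definition available (S : schedule) (t : R) (j : job) : bool :=
  (release j <= t) && (processed S t j < job_time (energy S) j).

Definition list_schedule (s : relax_solution) (S : schedule) : Prop :=
  energy S = s.1 /\
  forall t j, running S t j =
    available S t j &&
    (#|[pred k | available S t k && (s.2 k < s.2 j)%N]| < nmach I)%N.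

(* With continuous speeds these are sum_j w_j (v_j^a / E)^(1/(a-1)) and
   n (max_j w_j) / E^(1/(a-1)) * (sum_j v_j)^(a/(a-1)), see X_L_continuous and
   X_U_continuous. With discrete speeds the same bounds are expressed by the
   execution time function of that model: the power function formulas need not
   bound the sum of w_j x_j from above if the available speeds are too slow to
   spend the budget. *)
Definition X_L : R :=
  \sum_(j < njobs I)
    weight j * exec_time (alpha I) (speeds I) (vol j) (budget I).

Definition X_U : R :=
  (njobs I)%:R * max_weight *
  exec_time (alpha I) (speeds I) total_vol (budget I).

(* If all weights are 0 then X_L = X_U = 0, the quotient below is 0 and only
   i = 0 is tried. *)
Definition last_guess (eps' : R) : int :=
  Num.ceil (ln (X_U / X_L) / ln (1 + eps')).

Definition guess (eps' : R) (i : nat) : R := X_L * (1 + eps') ^+ i.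

(* S is an output of Fast-Relax+List-Scheduling when the augmented relaxation is
   solved by [solve]; [found i] is the schedule built in iteration i. *)
Definition fast_relax_list (eps : R) (solve : R -> option relax_solution)
    (S : schedule) : Prop :=
  let eps' := eps / 2 in
  exists found : nat -> option schedule,
  [/\ forall i : nat, i%:Z <= last_guess eps' ->
        match solve (guess eps' i) with
        | Some s => exists2 Si, found i = Some Si & list_schedule s Si
        | None => found i = None
        end,
      exists2 i : nat, i%:Z <= last_guess eps' & found i = Some S
    & forall (i : nat) Si, i%:Z <= last_guess eps' -> found i = Some Si ->
        cost S <= cost Si].

Lemma X_L_continuous : speeds I = Continuous ->
  X_L = \sum_(j < njobs I)
          weight j * (vol j `^ alpha I / budget I) `^ (alpha I - 1)^-1.
Proof. by rewrite /X_L => ->. Qed.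

Lemma X_U_continuous : speeds I = Continuous -> valid_instance ->
  X_U = (njobs I)%:R * max_weight / budget I `^ (alpha I - 1)^-1 *
        total_vol `^ (alpha I / (alpha I - 1)).
Proof.
rewrite /X_U => spI [_ _ _]; rewrite spI /= => E0.
rewrite powRM ?invr_ge0 ?powR_ge0 ?(ltW E0)// -powRrM.
rewrite -[(budget I)^-1]powR_inv1 ?(ltW E0)// -powRrM mulN1r powRN.
by rewrite -!mulrA; congr (_ * (_ * _)); rewrite mulrC.
Qed.

End Scheduling.

(* Main.v *)
(** The list schedule finishes each job j by r_j + x_j + (sum of x_k / m over the
    jobs k of no lower priority): from its release on, an unfinished job either
    runs or sees m jobs of higher priority running. Weighting and summing, its cost
    is at most sum w_j r_j + sum w_j x_j + (cost of the relaxed solution).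
    In a feasible schedule C_j >= r_j + x_j, and all jobs completed by C_j fit into
    m C_j units of machine time; hence sum w_j r_j + sum w_j x_j is at most its cost,
    and so is the cost of the relaxed solution with the same energies and the order
    of completion. For a guess X within a factor 1 + eps / 2 of the sum of w_j x_j,
    both parts of the bound lose only that factor.
    List schedules exist because availability can be defined one job at a time in
    priority order, from the measure of the time the previous jobs leave free. *)

Require Import Defs.
From HB Require Import structures.
From mathcomp Require Import all_boot all_order all_algebra all_fingroup.
From mathcomp Require Import all_classical all_reals all_analysis.
From mathcomp Require Import measurable_realfun ring lra.

Import Order.TTheory GRing.Theory Num.Theory numFieldNormedType.Exports.
Local Open Scope ring_scope.

(** * Time spent in a set before a given time *)

Section Occupied.
Context {R : realType}.
Implicit Types (U V : set (measurableTypeR R)) (s t x : R).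

(** [fine] sends an infinite measure to 0. For sets satisfying [nonneg_set] this case does not
    occur, since the part before [t] lies between 0 and [t]. *)
Definition occ U t : R :=
  fine (lebesgue_measure ([set u | u < t /\ U u]%classic : set (measurableTypeR R))).

Definition nonneg_set U := forall u, U u -> 0 <= u.

Lemma measurable_before {U} t : measurable U ->
  measurable ([set u | u < t /\ U u]%classic : set (measurableTypeR R)).
Proof.
move=> mU; rewrite (_ : mkset _ = (`]-oo, t[ `&` U)%classic); last first.
  by apply/seteqP; split=> u /=; rewrite in_itv.
exact: measurableI.
Qed.

Lemma occE {U} t : measurable U -> nonneg_set U ->
  lebesgue_measure ([set u | u < t /\ U u]%classic : set (measurableTypeR R)) =
  (occ U t)%:E.
Proof.
move=> mU U0; rewrite fineK// ge0_fin_numE//.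
apply: (@le_lt_trans _ _ (lebesgue_measure (`[0, t]%classic : set R))).
  apply: le_measure; rewrite ?inE//; first exact: measurable_before.
  by move=> u /= [ut /U0 u0]; rewrite in_itv/= u0 ltW.
rewrite lebesgue_measure_itv/=; case: ifP => _; last by rewrite ltry.
by rewrite -EFinB ltry.
Qed.

Lemma occ_ge0 U t : 0 <= occ U t.
Proof. exact: fine_ge0. Qed.

Lemma occ_sub {U V} s t : measurable U -> measurable V -> nonneg_set U ->
  nonneg_set V -> (forall u, u < s -> U u -> u < t /\ V u) -> occ U s <= occ V t.
Proof.
move=> mU mV U0 V0 UV; rewrite -lee_fin -!occE//.
apply: le_measure; rewrite ?inE; [exact: measurable_before..|].
by move=> u /= [us Uu]; exact: UV.
Qed.

Lemma measurable_from r :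
  measurable ([set u | r <= u]%classic : set (measurableTypeR R)).
Proof.
rewrite (_ : mkset _ = `[r, +oo[%classic); first exact: measurable_itv.
by apply/seteqP; split=> u; rewrite /= in_itv/= andbT.
Qed.

Lemma occ_le {U} s t : measurable U -> nonneg_set U -> s <= t ->
  occ U s <= occ U t.
Proof.
move=> mU U0 st; apply: occ_sub => // u us; split=> //.
exact: lt_le_trans us st.
Qed.

Lemma occ_lip {U} s t : measurable U -> nonneg_set U -> s <= t ->
  occ U t <= occ U s + (t - s).
Proof.
move=> mU U0 st; rewrite -lee_fin EFinD -!occE//.
have -> : (t - s)%:E = lebesgue_measure (`[s, t[%classic : set R).
  rewrite lebesgue_measure_itv/= lte_fin; case: ltP => //= ts.
  by rewrite (le_anti (introT andP (conj st ts))) subrr.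
apply: le_trans (measureU2 _ _ _); [|exact: measurable_before|exact: measurable_itv].
apply: le_measure; rewrite ?inE.
- exact: measurable_before.
- by apply: measurableU; [exact: measurable_before|exact: measurable_itv].
- move=> u /= [ut Uu]; rewrite in_itv/= ut andbT.
  by case: (ltP u s) => us; [left|right].
Qed.

Lemma occ_eq0 {U} r t : measurable U -> nonneg_set U ->
  (forall u, U u -> r <= u) -> t <= r -> occ U t = 0.
Proof.
move=> mU U0 Ur tr; rewrite /occ (_ : mkset _ = set0) ?measure0//.
apply/seteqP; split=> u //= [ut /Ur].
by rewrite leNgt (lt_le_trans ut tr).
Qed.

Lemma occ_itv {r t} : r <= t -> occ [set u | r <= u]%classic t = t - r.
Proof.
move=> rt; rewrite /occ (_ : mkset _ = (`[r, t[)%classic); last first.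
  by apply/seteqP; split=> u; rewrite /= in_itv/= andbC => /andP.
rewrite lebesgue_measure_itv/= lte_fin; case: ltP => //= tr.
by rewrite (@le_anti _ _ r t) ?subrr// rt tr.
Qed.

Lemma occ_continuous {U} : measurable U -> nonneg_set U ->
  continuous (occ U).
Proof.
move=> mU U0 t; apply/cvgrPdist_lt => e e0.
near=> s.
have : `|t - s| < e by near: s; exact: cvgr_dist_lt.
apply: le_lt_trans.
case: (leP t s) => [ts|/ltW st].
  rewrite distrC ger0_norm ?subr_ge0 ?occ_le// distrC ger0_norm ?subr_ge0//.
  by rewrite lerBlDl; exact: occ_lip.
rewrite ger0_norm ?subr_ge0 ?occ_le// ger0_norm ?subr_ge0//.
by rewrite lerBlDl; exact: occ_lip.
Unshelve. all: by end_near. Qed.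

Lemma occ_IVT {U} t x : measurable U -> nonneg_set U -> 0 <= x <= occ U t ->
  exists2 c, c <= t & occ U c = x.
Proof.
move=> mU U0 /andP[x0 xt].
have z0 : occ U 0 = 0 by apply: (occ_eq0 0).
case: (leP 0 t) => t0; last first.
  exists t => //; apply/le_anti; rewrite xt andbT.
  by rewrite -z0 in x0; apply: le_trans x0; apply: occ_le => //; exact: ltW.
have [||c] := @IVT R (occ U) 0 t x t0.
- by apply: continuous_subspaceT; exact: occ_continuous.
- by rewrite z0 min_l ?max_r ?x0// occ_ge0.
- by rewrite in_itv/= => /andP[_ ct] cx; exists c.
Qed.

(** Otherwise the level [x] is reached exactly at some [c]; by monotonicity no point of [U] lies at
    or after [c], so nothing accumulates later. *)
Lemma occ_stop {U} t x : measurable U -> nonneg_set U -> 0 <= x ->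
  (forall u, U u -> occ U u < x) -> occ U t <= x.
Proof.
move=> mU U0 x0 Ux; rewrite leNgt; apply/negP => xt.
have [c ct cx] : exists2 c, c <= t & occ U c = x.
  by apply: occ_IVT; rewrite // x0 ltW.
suff : occ U t <= occ U c by rewrite cx leNgt xt.
apply: occ_sub => // u _ Uu; split=> //; rewrite ltNge; apply/negP => cu.
by have := Ux u Uu; rewrite ltNge -cx occ_le.
Qed.

(** Points of [U] met before the level [x] is reached survive the truncation, so both sets
    accumulate alike up to that level. A job that stops when finished can thus be tested against the
    time offered to it. *)
Lemma occ_truncate {U} t x : measurable U -> nonneg_set U ->
  measurable ([set u | U u /\ occ U u < x]%classic : set (measurableTypeR R)) ->
  (occ [set u | U u /\ occ U u < x]%classic t < x) = (occ U t < x).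
Proof.
set V := mkset _ => mU U0 mV.
have V0 : nonneg_set V by move=> u [/U0].
apply/idP/idP => [Vx|]; last first.
  by apply: le_lt_trans; apply: occ_sub => // u ut [].
rewrite ltNge; apply/negP => xU.
(* At the time [c] when [U] has accumulated an intermediate amount [y], the truncation has not yet
   removed anything, so the truncated set has accumulated [y] too. *)
have [y Vy yx] : exists2 y, occ V t < y & y < x.
  by exists ((occ V t + x) / 2); lra.
have [c ct cy] : exists2 c, c <= t & occ U c = y.
  apply: occ_IVT; rewrite // (le_trans (ltW yx) xU) andbT.
  by apply: le_trans (ltW Vy); exact: occ_ge0.
suff : occ U c <= occ V t by rewrite cy leNgt Vy.
apply: occ_sub => // u uc Uu; split; first exact: lt_le_trans uc ct.
by split=> //; apply: le_lt_trans yx; rewrite -cy; apply: occ_le => //; exact: ltW.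
Qed.

Lemma measurable_occ_lt {U} x : measurable U -> nonneg_set U ->
  measurable ([set u | occ U u < x]%classic : set (measurableTypeR R)).
Proof.
move=> mU U0; apply: is_interval_measurable.
move=> a b /= ax bx c /andP[ac cb]; apply: le_lt_trans bx.
by apply: occ_le => //.
Qed.

(* Integrate the inequality between sums of indicator functions. *)
Lemma sum_occ_le {K L : finType} (P : pred K) (Q : pred L) (a : K -> R) (b : L -> R)
    (U : K -> set (measurableTypeR R)) (V : L -> set (measurableTypeR R)) t :
  (forall k, measurable (U k)) -> (forall k, nonneg_set (U k)) ->
  (forall l, measurable (V l)) -> (forall l, nonneg_set (V l)) ->
  (forall k, 0 <= a k) -> (forall l, 0 <= b l) ->
  (forall u, u < t -> \sum_(k | P k) a k * (u \in U k)%:R <=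
                      \sum_(l | Q l) b l * (u \in V l)%:R) ->
  \sum_(k | P k) a k * occ (U k) t <= \sum_(l | Q l) b l * occ (V l) t.
Proof.
move=> mU U0 mV V0 a0 b0 UV.
pose D : set (measurableTypeR R) := (`]-oo, t[)%classic.
have mD : measurable D by exact: measurable_itv.
have indE (W : set (measurableTypeR R)) (c : R) :
    measurable W -> nonneg_set W -> 0 <= c ->
    (\int[lebesgue_measure]_(u in D) (c * (u \in W)%:R)%:E = (c * occ W t)%:E)%E.
  move=> mW W0 c0.
  under eq_integral do rewrite EFinM.
  rewrite ge0_integralZl_EFin//; last first.
    apply/measurable_EFinP; exact: measurable_indic.
  rewrite (integral_indic lebesgue_measure mD mW).
  have -> : (W `&` D)%classic = [set u | u < t /\ W u]%classic.
    by apply/seteqP; split=> u; rewrite /D/= in_itv/= => -[].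
  by rewrite EFinM -occE.
have sumE (M : finType) (S : pred M) (c : M -> R) (W : M -> set (measurableTypeR R)) :
    (forall k, measurable (W k)) -> (forall k, nonneg_set (W k)) ->
    (forall k, 0 <= c k) ->
    (\int[lebesgue_measure]_(u in D) (\sum_(k | S k) c k * (u \in W k)%:R)%R%:E =
    (\sum_(k | S k) c k * occ (W k) t)%R%:E)%E.
  move=> mW W0 c0.
  (* [big_filter] turns the guarded sum into a sum over a list, the form that [ge0_integral_sum]
     handles. *)
  under eq_integral do rewrite -sumEFin -big_filter.
  rewrite ge0_integral_sum//.
  - by rewrite big_filter -sumEFin; apply: eq_bigr => k _; exact: indE.
  - move=> k; apply/measurable_EFinP; apply: measurable_funM => //.
    exact: measurable_indic.
  - by move=> k u _; rewrite lee_fin mulr_ge0.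
have sumM (M : finType) (S : pred M) (c : M -> R) (W : M -> set (measurableTypeR R)) :
    (forall k, measurable (W k)) ->
    measurable_fun D (fun u => (\sum_(k | S k) c k * (u \in W k)%:R)%:E).
  move=> mW; apply/measurable_EFinP; under eq_fun do rewrite -big_filter.
  apply: measurable_sum => k; apply: measurable_funM => //.
  exact: measurable_indic.
rewrite -lee_fin -!sumE//; apply: ge0_le_integral => //.
- by move=> u _; rewrite lee_fin sumr_ge0// => k _; rewrite mulr_ge0.
- exact: sumM.
- exact: sumM.
Qed.

End Occupied.

(** * Execution times *)

Section ExecTime.
Context {R : realType} {alpha : R} {md : speed_model R}.
Implicit Types v e c : R.

Definition durations {k} (speed : 'I_k -> R) v e : set R :=
  [set \sum_(i < k) t i | t in speed_profile alpha speed v e]%classic.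

Lemma durations_lbound {k} (speed : 'I_k -> R) v e :
  has_lbound (durations speed v e).
Proof. by exists 0 => _ [t [t0 _ _] <-]; apply: sumr_ge0. Qed.

Lemma speed_profile_scale {k} {speed : 'I_k -> R} {v e c t} : 0 <= c ->
  speed_profile alpha speed v e t ->
  speed_profile alpha speed (c * v) (c * e) (fun i => c * t i).
Proof.
move=> c0 [t0 tv te]; split.
- by move=> i; rewrite mulr_ge0.
- by rewrite -tv mulr_sumr; apply: eq_bigr => i _; rewrite mulrCA.
- apply: le_trans (ler_wpM2l c0 te); rewrite mulr_sumr le_eqVlt.
  by apply/orP; left; apply/eqP/eq_bigr => i _; rewrite mulrCA.
Qed.

Lemma admits_ge0 {v e} : admits alpha md v e -> 0 <= e.
Proof.
case: md => [|k speed] /=; first exact: ltW.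
move=> [t [t0 _]]; apply: le_trans; apply: sumr_ge0 => i _.
by rewrite mulr_ge0// powR_ge0.
Qed.

Lemma admits_le {v e e'} : e <= e' -> admits alpha md v e -> admits alpha md v e'.
Proof.
case: md => [|k speed] /= ee'; first by move=> /lt_le_trans; exact.
by move=> [t [t0 tv te]]; exists t; split=> //; exact: le_trans ee'.
Qed.

Lemma admits_scale {v e c} : 0 < c ->
  admits alpha md v e -> admits alpha md (c * v) (c * e).
Proof.
case: md => [|k speed] /= c0; first by rewrite pmulr_rgt0.
by move=> [t /(speed_profile_scale (ltW c0))]; eexists; eassumption.
Qed.

Lemma exec_time_le {v e e'} : 1 < alpha -> e <= e' -> admits alpha md v e ->
  exec_time alpha md v e' <= exec_time alpha md v e.
Proof.
move=> a1 ee'; case: md => [|k speed] /=.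
  move=> e0; have e'0 := lt_le_trans e0 ee'.
  apply: ge0_ler_powR; rewrite ?invr_ge0 ?subr_ge0 ?(ltW a1)// ?nnegrE.
  - by rewrite divr_ge0 ?powR_ge0 ?ltW.
  - by rewrite divr_ge0 ?powR_ge0 ?ltW.
  - by rewrite ler_wpM2l ?powR_ge0// lef_pV2.
move=> [t tP]; apply: lb_le_inf; first by exists (\sum_(i < k) t i); exists t.
move=> _ [s [s0 sv se] <-]; apply: ge_inf; first exact: durations_lbound.
by exists s => //; split=> //; exact: le_trans ee'.
Qed.

(** Keeping the speeds and multiplying all times by [c] multiplies both volume and energy by [c]. *)
Lemma exec_time_scale {v e c} : 1 < alpha -> 0 < c -> 0 < v ->
  admits alpha md v e ->
  exec_time alpha md (c * v) (c * e) <= c * exec_time alpha md v e.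
Proof.
move=> a1 c0 v0; have am1 : 0 < alpha - 1 by rewrite subr_gt0.
case: md => [|k speed] /=.
  move=> e0; rewrite (@powRM _ c v) ?(ltW c0) ?(ltW v0)//.
  have -> : c `^ alpha * v `^ alpha / (c * e) = c `^ (alpha - 1) * (v `^ alpha / e).
    rewrite powRB ?(gt_eqF c0) ?implybT// powRr1 ?(ltW c0)//.
    by field; rewrite !gt_eqF.
  rewrite powRM ?powR_ge0// ?divr_ge0 ?powR_ge0 ?(ltW e0)//.
  by rewrite -powRrM divff ?gt_eqF// powRr1 ?(ltW c0).
move=> [t tP]; rewrite -ler_pdivrMl//.
apply: lb_le_inf; first by exists (\sum_(i < k) t i); exists t.
move=> _ [s sP <-]; rewrite ler_pdivrMl// mulr_sumr.
apply: ge_inf; first exact: durations_lbound.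
by exists (fun i => c * s i) => //; apply: speed_profile_scale => //; exact: ltW.
Qed.

Lemma exec_time_gt0 {v e} : 1 < alpha -> 0 < v ->
  (if md is Discrete k speed then forall i, 0 <= speed i else True) ->
  admits alpha md v e -> 0 < exec_time alpha md v e.
Proof.
move=> a1 v0; case: md => [_|k speed sp0] /=.
  by move=> e0; rewrite powR_gt0// divr_gt0// powR_gt0.
(* Positivity has to survive the infimum: [M] bounds every single speed, so all durations are at
   least [v / M]. *)
move=> [t tP]; pose M := \sum_(i < k) speed i.
have vM s : speed_profile alpha speed v e s -> v <= M * \sum_(i < k) s i.
  move=> [s0 <- _]; rewrite mulr_sumr; apply: ler_sum => i _.
  apply: ler_wpM2r => //; rewrite /M (bigD1 i)//= lerDl.
  by apply: sumr_ge0.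
have M0 : 0 < M.
  rewrite lt_def sumr_ge0// andbT; apply/eqP => M0.
  by move: (vM _ tP); rewrite M0 mul0r leNgt v0.
apply: (@lt_le_trans _ _ (v / M)); first exact: divr_gt0.
apply: lb_le_inf; first by exists (\sum_(i < k) t i); exists t.
by move=> _ [s sP <-]; rewrite ler_pdivrMr// mulrC; exact: vM.
Qed.

End ExecTime.

(** * Feasible schedules and list schedules *)

(** If fewer than [m] elements had rank below [m], take the first element of [A] in the order [pi]
    that is not among them. All its predecessors in [A] are among them, so its own rank is below
    [m], a contradiction. *)
Lemma card_low_rank {n m : nat} (pi : {perm 'I_n}) (A : pred 'I_n) :
  (m <= #|A|)%N ->
  (m <= #|[pred k | A k && (#|[pred l | A l && (pi l < pi k)%N]| < m)%N]|)%N.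
Proof.
set T := [pred k | _] => mA; rewrite leqNgt; apply/negP => Tm.
have [k0 k0P] : exists k, A k && ~~ T k.
  apply/existsP; apply: contraLR Tm => /existsPn AT; rewrite -leqNgt.
  apply: leq_trans mA _; apply: subset_leq_card; apply/fintype.subsetP => k.
  by move=> Ak; have := AT k; rewrite (Ak : A k = true) /= negbK.
have [k /andP[Ak TkN] kmin] :=
  arg_minnP (P := fun k => A k && ~~ T k) (fun k => val (pi k)) k0P.
case/negP: TkN; rewrite /T/= Ak/=; apply: leq_ltn_trans Tm.
apply: subset_leq_card; apply/fintype.subsetP => l; rewrite !inE => /andP[Al lk].
apply: contraLR lk; rewrite -leqNgt => Tl; apply: kmin.
by rewrite (Al : A l = true); exact: Tl.
Qed.

Section ScheduleFacts.
Context {R : realType} {I : instance R}.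
Local Notation job := 'I_(njobs I).
Implicit Types (S : schedule I) (j k : job) (t u : R).

Definition runset S j : set (measurableTypeR R) := [set u | running S u j]%classic.

Lemma processedE S t j : processed S t j = occ (runset S j) t.
Proof. by []. Qed.

Lemma measurable_runset S j : measurable (runset S j).
Proof.
have -> : runset S j =
    (\bigcup_(i in setT) [set u | run S i u = Some j])%classic.
  apply/seteqP; split=> u /=.
    by move=> /existsP[i /eqP ij]; exists i.
  by move=> [i _ ij]; apply/existsP; exists i; apply/eqP.
apply: fin_bigcup_measurable; first exact: finite_finset.
by move=> i _; exact: run_measurable.
Qed.

Lemma card_running S u : (#|[pred j | running S u j]| <= nmach I)%N.
Proof.
have Some_inj : injective (@Some 'I_(njobs I)) by move=> ? ? [].
rewrite -(finset.card_imset _ Some_inj) -[leqRHS]card_ord.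
apply: leq_trans (leq_imset_card (fun i => run S i u) (mem 'I_(nmach I))).
apply/subset_leq_card/fintype.subsetP => oj /imsetP[j].
by rewrite inE => /existsP[i /eqP <-] ->; apply/imsetP; exists i.
Qed.

Hypothesis validI : valid_instance I.

Lemma nmach_gt0 : 0 < (nmach I)%:R :> R.
Proof. by case: validI => -[+ _]; rewrite ltr0n. Qed.

Lemma job_time_gt0 (en : job -> R) j : energy_assignment en -> 0 < job_time en j.
Proof.
case: validI => -[_ a1] /(_ j)[v0 _ _] sp _ [adm _].
exact: (exec_time_gt0 a1 v0 sp).
Qed.

Lemma weight_ge0 j : 0 <= weight j.
Proof. by case: validI => _ /(_ j)[]. Qed.

Lemma release_ge0 j : 0 <= release j.
Proof. by case: validI => _ /(_ j)[]. Qed.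

Section AfterRelease.
Variable S : schedule I.
Hypothesis running_release : forall t j, running S t j -> release j <= t.

Lemma nonneg_runset j : nonneg_set (runset S j).
Proof. by move=> u /running_release; apply: le_trans; exact: release_ge0. Qed.

Lemma processed_le s t j : s <= t -> processed S s j <= processed S t j.
Proof. by apply: occ_le; [exact: measurable_runset|exact: nonneg_runset]. Qed.

(** Positivity excludes times before the release, where the right-hand side is negative. *)
Lemma processed_le_elapsed t j :
  0 < processed S t j -> processed S t j <= t - release j.
Proof.
move=> pos.
have rt : release j < t.
  rewrite ltNge; apply/negP => tr.
  move: pos; rewrite processedE (occ_eq0 (release j)) ?ltxx//.
  - exact: measurable_runset.
  - exact: nonneg_runset.
  - by move=> u /running_release.
rewrite -(occ_itv (ltW rt)); apply: occ_sub.
- exact: measurable_runset.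
- exact: measurable_from.
- exact: nonneg_runset.
- by move=> u; apply: le_trans; exact: release_ge0.
- by move=> u ut /running_release.
Qed.

Lemma sum_processed_le (P : pred job) t : 0 <= t ->
  \sum_(j | P j) processed S t j <= (nmach I)%:R * t.
Proof.
move=> t0.
have := @sum_occ_le R job 'I_1 P xpredT (fun=> 1) (fun=> (nmach I)%:R)
  (runset S) (fun=> [set u | 0 <= u]%classic) t.
rewrite big_ord1 occ_itv// subr0; under eq_bigr do rewrite mul1r.
move=> occ_le_occ; apply: occ_le_occ => //.
- exact: measurable_runset.
- exact: nonneg_runset.
- by move=> _; exact: measurable_from.
- by move=> _ u.
move=> u _; rewrite big_ord1; under eq_bigr do rewrite mul1r.
case: (leP 0 u) => u0; last first.
  rewrite big1 ?mulr_ge0// => j _; rewrite memNset// => /nonneg_runset.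
  by rewrite leNgt u0.
rewrite mem_set//= mulr1 -natr_sum ler_nat.
apply: leq_trans (card_running S u); rewrite -sum1_card.
rewrite [leqLHS]big_mkcond [leqRHS]big_mkcond/=; apply: leq_sum => j _.
rewrite inE; case: (P j) => //; case: ifP => [_|jN]; first exact: leq_b1.
by rewrite memNset// /runset/= jN.
Qed.

End AfterRelease.

Lemma completion_ge S j : feasible S ->
  release j + job_time (energy S) j <= completion S j.
Proof.
move=> [en rel _ fin]; apply: lb_le_inf; first exact: fin.
move=> t /= tj; rewrite addrC -lerBrDr -tj; apply: processed_le_elapsed => //.
by rewrite tj job_time_gt0.
Qed.

(** A time beyond the infimum exceeds some time at which the job is finished, and processing is
    monotone and capped. *)
Lemma processed_after S t j : feasible S -> completion S j < t ->
  processed S t j = job_time (energy S) j.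
Proof.
move=> [en rel le fin] Ct; apply/le_anti; rewrite le/=.
have [||s /= sj st] := @inf_adherent _
    [set t | processed S t j = job_time (energy S) j]%classic (t - completion S j).
- by rewrite subr_gt0.
- split; first exact: fin.
  exists (release j) => s /= sj; rewrite -subr_ge0.
  apply: (@le_trans _ _ (processed S s j)); last first.
    by apply: processed_le_elapsed => //; rewrite sj job_time_gt0.
  by rewrite sj ltW// job_time_gt0.
- by rewrite -sj; apply: processed_le => //; move: st; rewrite addrC subrK => /ltW.
Qed.

Lemma sum_job_time_le S (P : pred job) t : feasible S -> 0 <= t ->
  (forall k, P k -> completion S k <= t) ->
  \sum_(k | P k) job_time (energy S) k <= (nmach I)%:R * t.
Proof.
move=> fS t0 Pt; rewrite mulrC -ler_pdivrMr ?nmach_gt0//.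
apply/ler_addgt0Pr => e e0; rewrite ler_pdivrMr ?nmach_gt0// mulrC.
have [_ rel _ _] := fS.
apply: le_trans (@sum_processed_le S rel P (t + e) _).
  apply: ler_sum => k Pk; rewrite (@processed_after S (t + e) k)//.
  by apply: le_lt_trans (Pt k Pk) _; rewrite ltrDl.
by rewrite addr_ge0// ltW.
Qed.

End ScheduleFacts.

(** * Analysis of list schedules *)

Section ListScheduling.
Context {R : realType} {I : instance R} {s : relax_solution I} {S : schedule I}.
Local Notation job := 'I_(njobs I).
Implicit Types (j k : job) (t u : R).
Hypotheses (validI : valid_instance I) (ens : energy_assignment s.1).
Hypothesis listS : list_schedule s S.

Lemma list_running_release t j : running S t j -> release j <= t.
Proof. by case: listS => _ ->; rewrite /available => /andP[/andP[]]. Qed.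

Lemma list_processed_le t j : processed S t j <= job_time (energy S) j.
Proof.
have [enS runS] := listS.
apply: occ_stop.
- exact: measurable_runset.
- by apply: nonneg_runset => //; exact: list_running_release.
- by rewrite ltW// job_time_gt0// enS.
- by move=> u /=; rewrite /runset/= runS => /andP[/andP[]].
Qed.

(** At least [nmach I] available jobs precede [j], and by [card_low_rank] that many of them have
    rank low enough to run. *)
Lemma list_busy {u j} : available S u j -> ~~ running S u j ->
  (nmach I <= #|[pred k | running S u k && (s.2 k < s.2 j)%N]|)%N.
Proof.
have [_ runS] := listS; rewrite runS => -> /=; rewrite -leqNgt.
move=> /(card_low_rank s.2)/leq_trans; apply; apply: subset_leq_card.
apply/fintype.subsetP => k; rewrite !inE /= => /andP[/andP[Ak kj] km].
rewrite runS Ak kj andbT/=; apply: leq_ltn_trans km.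
apply: subset_leq_card; apply/fintype.subsetP => l; rewrite !inE => /andP[-> lk].
by rewrite lk (ltn_trans lk kj).
Qed.

(** At each moment between the release and [t], either [j] runs or [nmach I] jobs of higher priority
    do. Counting [j] with multiplicity [nmach I], the indicators of running jobs add up to at least
    [nmach I]; integrating gives the bound. *)
Lemma list_progress {t j} : release j <= t ->
  processed S t j < job_time (energy S) j ->
  (nmach I)%:R * (t - release j) <=
  (nmach I)%:R * processed S t j + \sum_(k | (s.2 k < s.2 j)%N) processed S t k.
Proof.
move=> rt unfin; have rel := list_running_release.
pose b k : R := if k == j then (nmach I)%:R else 1.
have := @sum_occ_le R 'I_1 job xpredT (fun k => s.2 k <= s.2 j)%N
  (fun=> (nmach I)%:R) b (fun=> [set u | release j <= u]%classic) (runset S) t.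
have splitE (F : job -> R) : \sum_(k | (s.2 k <= s.2 j)%N) b k * F k =
    (nmach I)%:R * F j + \sum_(k | (s.2 k < s.2 j)%N) F k.
  rewrite (bigD1 j)//= {1}/b eqxx; congr (_ + _); apply: eq_big => k.
    by rewrite ltn_neqAle andbC (inj_eq val_inj) (inj_eq perm_inj).
  by rewrite /b => /andP[_ /negbTE->]; rewrite mul1r.
rewrite big_ord1 occ_itv// splitE => occ_le_occ; apply: occ_le_occ => //.
- by move=> _; exact: measurable_from.
- by move=> _ u; apply: le_trans; exact: release_ge0.
- exact: measurable_runset.
- exact: nonneg_runset.
- by move=> k; rewrite /b; case: ifP.
move=> u ut; rewrite big_ord1 splitE.
case: (leP (release j) u) => ru; last first.
  rewrite memNset /=; last by rewrite leNgt ru.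
  by rewrite mulr0 addr_ge0// ?mulr_ge0// sumr_ge0.
rewrite mem_set//= mulr1; case: (boolP (running S u j)) => uj.
  by rewrite (mem_set (uj : runset S j u)) mulr1 lerDl sumr_ge0.
rewrite (memNset (negP uj : ~ runset S j u)) mulr0 add0r -natr_sum ler_nat.
(* A job unfinished at [t] is unfinished at every earlier [u]. *)
have Auj : available S u j.
  by rewrite /available ru (le_lt_trans _ unfin)// processed_le// ltW.
apply: leq_trans (list_busy Auj uj) _; rewrite -sum1_card.
rewrite [leqLHS]big_mkcond [leqRHS]big_mkcond/=; apply: leq_sum => k _.
rewrite inE; case: (_ < _)%N; rewrite ?andbF// andbT; case: ifP => // uk.
by rewrite (mem_set (uk : runset S k u)).
Qed.

(** The last sum is the completion time of [j] in the relaxation, so it also counts the fast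
    execution time of [j] itself. *)
Definition list_bound j : R := release j + job_time s.1 j +
  \sum_(k | (s.2 k <= s.2 j)%N) fast_time s.1 k.

Lemma fast_time_ge0 (en : job -> R) j : energy_assignment en -> 0 <= fast_time en j.
Proof. by move=> enA; rewrite divr_ge0// ltW// job_time_gt0. Qed.

(** If [j] were unfinished, [list_progress] would bound the machine time since its release by
    strictly less than [nmach I] times its own execution time plus the full execution times of the
    jobs before it. *)
Lemma list_finished j : processed S (list_bound j) j = job_time (energy S) j.
Proof.
have [enS _] := listS.
apply/le_anti; rewrite list_processed_le/= leNgt; apply/negP => unfin.
have xj : 0 < job_time s.1 j by rewrite job_time_gt0.
have fs : 0 <= \sum_(k | (s.2 k < s.2 j)%N) fast_time s.1 k.
  by apply: sumr_ge0 => k _; exact: fast_time_ge0.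
have fle : \sum_(k | (s.2 k < s.2 j)%N) fast_time s.1 k <=
    \sum_(k | (s.2 k <= s.2 j)%N) fast_time s.1 k.
  rewrite [leLHS]big_mkcond [leRHS]big_mkcond/=; apply: ler_sum => k _.
  by case: ltngtP => // _; exact: fast_time_ge0.
have rD : release j <= list_bound j by rewrite /list_bound; lra.
have := list_progress rD unfin; rewrite leNgt => /negP; apply.
have m0 := nmach_gt0 validI.
apply: (@lt_le_trans _ _ ((nmach I)%:R * (job_time s.1 j +
    \sum_(k | (s.2 k < s.2 j)%N) fast_time s.1 k))); last first.
  by rewrite ler_wpM2l// /list_bound; lra.
rewrite mulrDr ltr_leD//; first by rewrite ltr_pM2l// -enS.
rewrite mulr_sumr; apply: ler_sum => k _.
by rewrite /fast_time mulrC divfK ?gt_eqF// -enS list_processed_le.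
Qed.

Lemma list_feasible : feasible S.
Proof.
split.
- by case: listS => ->.
- exact: list_running_release.
- exact: list_processed_le.
- by move=> j; exists (list_bound j); exact: list_finished.
Qed.

Lemma list_cost_le : cost S <= \sum_(j < njobs I) weight j * release j +
  \sum_(j < njobs I) weight j * job_time s.1 j + relax_cost s.
Proof.
rewrite -!big_split/=; apply: ler_sum => j _; rewrite -!mulrDr.
apply: ler_wpM2l; first exact: weight_ge0.
apply: ge_inf; last exact: list_finished.
exists (release j) => t /= tj; rewrite -subr_ge0.
have pos : 0 < job_time (energy S) j by case: listS => ->; rewrite job_time_gt0.
apply: (@le_trans _ _ (processed S t j)); first by rewrite tj ltW.
by apply: processed_le_elapsed; rewrite ?tj//; exact: list_running_release.
Qed.

End ListScheduling.

(** * The relaxation and the guesses *)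

(** The position in a list sorted by [C] is such a permutation; ties are broken by the place in the
    list. *)
Lemma perm_by_key {R : realType} {n : nat} (C : 'I_n -> R) :
  exists pi : {perm 'I_n}, forall j k, (pi k <= pi j)%N -> C k <= C j.
Proof.
pose r : rel 'I_n := fun j k => C j <= C k.
pose l := sort r (enum 'I_n).
have mem_l k : k \in l by rewrite mem_sort mem_enum.
have ltl k : (index k l < n)%N.
  by rewrite -[ltnRHS](size_enum_ord n) -(size_sort r) index_mem.
have f_inj : injective (fun k => Ordinal (ltl k)).
  by move=> j k [] jk; rewrite -(nth_index j (mem_l j)) jk nth_index.
exists (perm f_inj) => j k; rewrite !permE/=.
apply: (@sorted_leq_index _ r) => //.
- by move=> y x z; exact: le_trans.
- by move=> x; exact: lexx.
- by apply: sort_sorted => x y; exact: le_total.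
Qed.

Section Relaxation.
Context {R : realType} {I : instance R}.
Local Notation job := 'I_(njobs I).
Implicit Types (S : schedule I) (s : relax_solution I) (en : job -> R) (j k : job).
Hypothesis validI : valid_instance I.

Lemma relax_feasibleE X s : relax_feasible X s <->
  energy_assignment s.1 /\ \sum_(j < njobs I) weight j * job_time s.1 j <= X.
Proof.
rewrite /relax_feasible; under eq_bigr => j _.
  rewrite /fast_time [_%:R * _]mulrC divfK ?gt_eqF ?nmach_gt0//; over.
by [].
Qed.

Lemma relax_opt_le {X s} : relax_feasible X s -> relax_opt I X <= relax_cost s.
Proof.
move=> sX; apply: ge_inf; last by exists s.
exists 0 => _ [s' [ens' _] <-]; apply: sumr_ge0 => j _.
rewrite mulr_ge0 ?weight_ge0// sumr_ge0// => k _.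
by rewrite fast_time_ge0.
Qed.

(** In the order of completion, the jobs up to [j] are all finished by the completion time of [j],
    so their total execution time divided by [nmach I] is at most that time. *)
Lemma relax_cost_le_cost {S} : feasible S ->
  exists pi : {perm job}, relax_cost (energy S, pi) <= cost S.
Proof.
move=> fS; have [pi piC] := perm_by_key (completion S).
exists pi; apply: ler_sum => j _; rewrite ler_wpM2l ?weight_ge0//=.
rewrite -mulr_suml ler_pdivrMr ?nmach_gt0// mulrC.
apply: sum_job_time_le => // [|k]; last exact: piC.
apply: le_trans (completion_ge validI _ j fS).
by have [enS _ _ _] := fS; rewrite addr_ge0 ?release_ge0// ltW// job_time_gt0.
Qed.

Lemma release_exec_le_cost {S} : feasible S ->
  \sum_(j < njobs I) weight j * release j +
  \sum_(j < njobs I) weight j * job_time (energy S) j <= cost S.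
Proof.
move=> fS; rewrite -big_split/=; apply: ler_sum => j _.
by rewrite -mulrDr ler_wpM2l ?weight_ge0// completion_ge.
Qed.

Lemma energy_le_budget {en} j : energy_assignment en -> en j <= budget I.
Proof.
move=> [adm]; apply: le_trans; rewrite (bigD1 j)//= lerDl sumr_ge0// => k _.
exact: admits_ge0 (adm k).
Qed.

(** No job receives more than the whole budget, and additional energy never slows a job down. *)
Lemma X_L_le {en} : energy_assignment en ->
  X_L I <= \sum_(j < njobs I) weight j * job_time en j.
Proof.
move=> enA; apply: ler_sum => j _; rewrite ler_wpM2l ?weight_ge0//.
have [[_ a1] _ _ _] := validI.
by apply: exec_time_le => //; [exact: energy_le_budget|case: enA].
Qed.

(** Every job gets the same energy per unit of volume, which makes it a scaled copy of one job with
    the whole volume and the whole budget. *)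
Definition uniform_energy j : R := vol j / total_vol I * budget I.

Lemma vol_gt0 j : 0 < vol j.
Proof. by case: validI => _ /(_ j)[]. Qed.

Lemma vol_le_total j : vol j <= total_vol I.
Proof.
rewrite /total_vol (bigD1 j)//= lerDl sumr_ge0// => k _.
by rewrite ltW// vol_gt0.
Qed.

Lemma total_vol_gt0 j : 0 < total_vol I.
Proof. exact: lt_le_trans (vol_gt0 j) (vol_le_total j). Qed.

(** Equality fails without jobs, where the sum is 0. *)
Lemma sum_share_le1 : \sum_(j < njobs I) vol j / total_vol I <= 1.
Proof.
rewrite -mulr_suml -/(total_vol I).
by have [->|V0] := eqVneq (total_vol I) 0; rewrite ?mul0r ?divff.
Qed.

Lemma uniform_energy_assignment : energy_assignment uniform_energy.
Proof.
have [_ _ _ admT] := validI; split => [j|].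
  have V0 := total_vol_gt0 j.
  rewrite -[vol j](@divfK _ (total_vol I)) ?gt_eqF//.
  by apply: admits_scale => //; rewrite divr_gt0 ?vol_gt0.
rewrite -mulr_suml; apply: ler_piMl; first exact: admits_ge0 admT.
exact: sum_share_le1.
Qed.

Let T := exec_time (alpha I) (speeds I) (total_vol I) (budget I).

Lemma uniform_job_time j : job_time uniform_energy j <= vol j / total_vol I * T.
Proof.
have [[_ a1] _ _ admT] := validI; have V0 := total_vol_gt0 j.
rewrite /job_time -[X in exec_time _ _ X](@divfK _ (total_vol I)) ?gt_eqF//.
by apply: exec_time_scale => //; rewrite divr_gt0 ?vol_gt0.
Qed.

Lemma total_time_gt0 j : 0 < T.
Proof.
have [[_ a1] _ sp admT] := validI.
exact: (exec_time_gt0 a1 (total_vol_gt0 j) sp).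
Qed.

Lemma weight_le_max j : weight j <= max_weight I.
Proof. exact: le_bigmax. Qed.

Lemma X_UE : X_U I = \sum_(j < njobs I) max_weight I * T.
Proof. by rewrite sumr_const card_ord -mulr_natl mulrA. Qed.

Lemma uniform_weighted_time_le :
  \sum_(j < njobs I) weight j * job_time uniform_energy j <= X_U I.
Proof.
rewrite X_UE; apply: ler_sum => j _; have V0 := total_vol_gt0 j.
rewrite ler_pM ?weight_ge0 ?weight_le_max//.
  by rewrite ltW// job_time_gt0//; exact: uniform_energy_assignment.
apply: le_trans (uniform_job_time j) _; apply: ler_piMl.
  by rewrite ltW// (total_time_gt0 j).
by rewrite ler_pdivrMr// mul1r vol_le_total.
Qed.

Lemma uniform_relax_cost_le (pi : {perm job}) :
  relax_cost (uniform_energy, pi) <= X_U I.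
Proof.
have uA := uniform_energy_assignment.
rewrite X_UE; apply: ler_sum => j _; have T0 := total_time_gt0 j.
rewrite ler_pM ?weight_ge0 ?weight_le_max//=.
  by rewrite sumr_ge0// => k _; rewrite fast_time_ge0.
apply: (@le_trans _ _ (\sum_(k < njobs I) vol k / total_vol I * T)); last first.
  by rewrite -mulr_suml ler_piMl ?sum_share_le1// ltW.
rewrite big_mkcond/=; apply: ler_sum => k _.
(* The speedup by [nmach I] is given away: the unscaled execution times already add up to at most
   [T]. *)
apply: (@le_trans _ _ (job_time uniform_energy k)); last exact: uniform_job_time.
have x0 : 0 <= job_time uniform_energy k by rewrite ltW// job_time_gt0.
case: ifP => // _; rewrite ler_pdivrMr ?nmach_gt0// ler_peMr//.
by rewrite ler1n; case: validI => -[].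
Qed.

Lemma X_L_le_X_U : X_L I <= X_U I.
Proof.
exact: le_trans (X_L_le uniform_energy_assignment) uniform_weighted_time_le.
Qed.

Lemma exec_time_budget_gt0 j :
  0 < exec_time (alpha I) (speeds I) (vol j) (budget I).
Proof.
have [[_ a1] _ sp _] := validI.
apply: (exec_time_gt0 a1 (vol_gt0 j) sp).
have uA := uniform_energy_assignment.
by apply: admits_le (energy_le_budget j uA) _; case: uA.
Qed.

Lemma X_L_ge0 : 0 <= X_L I.
Proof.
apply: sumr_ge0 => j _; apply: mulr_ge0; first exact: weight_ge0.
by rewrite ltW// exec_time_budget_gt0.
Qed.

(** Execution times are positive, so a vanishing [X_L] forces all weights, and hence their maximum,
    to be 0. *)
Lemma X_U_eq0 : X_L I = 0 -> X_U I = 0.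
Proof.
move=> /eqP; rewrite psumr_eq0; last first.
  by move=> j _; rewrite mulr_ge0 ?weight_ge0// ltW// exec_time_budget_gt0.
move=> /allP w0; suff -> : X_U I = (njobs I)%:R * 0 * T by rewrite mulr0 mul0r.
congr (_ * _ * _); apply: (big_ind (fun x => x = 0)) => // [_ _ -> ->|j _].
  exact: maxxx.
have := w0 j (mem_index_enum j).
by rewrite /= mulf_eq0 (gt_eqF (exec_time_budget_gt0 j)) orbF => /eqP.
Qed.

(** Take the least [i] whose guess reaches [Y]; it is in range because the last guess reaches [X_U].
    Either [i] is 0 and the guess is [X_L], or the previous guess is still below [Y]. *)
Lemma guess_cover {e Y : R} : 0 < e -> X_L I <= Y <= X_U I ->
  exists i : nat, [/\ i%:Z <= last_guess I e, Y <= guess I e i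
                    & guess I e i <= (1 + e) * Y].
Proof.
move=> e0 /andP[LY YU]; have e1 : 1 < 1 + e by rewrite ltrDl.
have := X_L_ge0; rewrite le_eqVlt => /predU1P[/esym L0|L0].
  have Y0 : Y = 0 by apply/le_anti; rewrite -{2}L0 LY andbT -(X_U_eq0 L0).
  (* Division by 0 and [ln 0] both give 0, so [last_guess] is 0 and only this guess remains. *)
  exists 0; rewrite /last_guess /guess L0 Y0 invr0 mulr0 mul0r mulr0 ln0// mul0r.
  by rewrite ceil0.
have Y0 := lt_le_trans L0 LY.
have U0 := lt_le_trans Y0 YU.
have lne : 0 < ln (1 + e) by rewrite ln_gt0.
have G0 : 0 <= last_guess I e.
  rewrite /last_guess -(ceil0 R); apply: le_ceil; rewrite divr_ge0 ?ln_ge0 ?(ltW e1)//.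
  by rewrite ler_pdivlMr// mul1r (le_trans LY).
pose N := `|last_guess I e|%N.
have NE : N%:Z = last_guess I e by rewrite /N gez0_abs.
have UN : X_U I <= guess I e N.
  have e10 : 0 < 1 + e by exact: lt_trans e1.
  rewrite /guess mulrC -ler_pdivrMr// -ler_ln; last 2 first.
  - by rewrite posrE divr_gt0.
  - by rewrite posrE exprn_gt0.
  rewrite lnXn// -mulr_natl -ler_pdivrMr//.
  by have := ceil_ge (ln (X_U I / X_L I) / ln (1 + e)); rewrite -/(last_guess I e) -NE.
have exG : exists i, Y <= guess I e i by exists N; exact: le_trans UN.
case: (ex_minnP exG) => i Yi imin; exists i; split=> //.
  by rewrite -NE lez_nat imin// (le_trans YU).
case: i Yi imin => [|i] Yi imin.
  by rewrite /guess expr0 mulr1 (le_trans LY)// ler_peMl ?(ltW Y0)// ltW.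
rewrite /guess exprS mulrCA ler_pM2l ?(lt_trans ltr01)// leNgt; apply/negP => YG.
by have := imin i (ltW YG); rewrite ltnn.
Qed.

(* If S spends more than X_U on weighted execution times, sharing the budget in
   proportion to the volumes gives a relaxed solution that costs at most X_U. *)
Lemma relax_solution_exists {S} : feasible S ->
  exists s Y, [/\ X_L I <= Y <= X_U I,
    Y <= \sum_(j < njobs I) weight j * job_time (energy S) j,
    relax_feasible Y s & relax_cost s <= cost S].
Proof.
move=> fS; have [enS _ _ _] := fS.
case: (leP (\sum_(j < njobs I) weight j * job_time (energy S) j) (X_U I)) => [XU|UX].
  have [pi piS] := relax_cost_le_cost fS.
  exists (energy S, pi), (\sum_(j < njobs I) weight j * job_time (energy S) j).
  by rewrite XU X_L_le//; split=> //; apply/relax_feasibleE.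
exists (uniform_energy, 1%g), (X_U I); rewrite X_L_le_X_U lexx; split=> //.
- exact: ltW.
- apply/relax_feasibleE; split; first exact: uniform_energy_assignment.
  exact: uniform_weighted_time_le.
apply: le_trans (uniform_relax_cost_le _) _; apply: le_trans (ltW UX) _.
apply: le_trans (release_exec_le_cost fS); rewrite lerDr sumr_ge0// => j _.
by rewrite mulr_ge0 ?weight_ge0 ?release_ge0.
Qed.

(** * Feasibility and cost of the output *)

Lemma output_feasible {eps solve S} : relax_approx (1 + eps / 2) solve ->
  fast_relax_list eps solve S -> feasible S.
Proof.
move=> solveP [found [foundP [i il foundi] _]].
have := foundP i il; have := solveP (guess I (eps / 2) i).
case: (solve _) => [s [[ens _] _] [Si]|_]; rewrite foundi => // -[->] listS.
exact: list_feasible listS.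
Qed.

(** Let [a] and [b] be the weighted sums of release dates and execution times in [S']. The output
    costs at most [a + (1 + eps / 2) * b + (1 + eps / 2) * cost S'], and [a + b <= cost S']. *)
Lemma output_cost_le {eps solve S S'} : 0 < eps ->
  relax_approx (1 + eps / 2) solve -> fast_relax_list eps solve S ->
  feasible S' -> cost S <= (2 + eps) * cost S'.
Proof.
move=> eps0 solveP [found [foundP _ Smin]] fS'.
have e0 : 0 < eps / 2 by rewrite divr_gt0.
have e1 : 0 <= 1 + eps / 2 by rewrite addr_ge0// ltW.
(* The guess is matched to [Y], since the weighted execution times of [S'] may exceed [X_U]. *)
have [s' [Y [YLU YX [ens' s'Y] s'S']]] := relax_solution_exists fS'.
have [i [il Yi iY]] := guess_cover e0 YLU.
have s'i : relax_feasible (guess I (eps / 2) i) s'.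
  by split=> //; exact: le_trans Yi.
have := foundP i il; have := solveP (guess I (eps / 2) i).
case: (solve _) => [s [si sopt] [Si foundi listSi]|/(_ s')//].
have [ens sX] := (relax_feasibleE _ _).1 si.
have SSi := Smin _ _ il foundi.
have Sicost := list_cost_le validI ens listSi.
have s's : relax_cost s <= (1 + eps / 2) * cost S'.
  apply: le_trans sopt _; rewrite ler_wpM2l//.
  exact: le_trans (relax_opt_le s'i) s'S'.
have S'lb := release_exec_le_cost fS'.
have wr0 : 0 <= \sum_(j < njobs I) weight j * release j.
  by apply: sumr_ge0 => j _; rewrite mulr_ge0 ?weight_ge0 ?release_ge0.
have := ler_wpM2l (ltW e0) wr0.
have : guess I (eps / 2) i <= (1 + eps / 2) *
    \sum_(j < njobs I) weight j * job_time (energy S') j.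
  by apply: le_trans iY _; rewrite ler_wpM2l.
have : (1 + eps / 2) * (\sum_(j < njobs I) weight j * release j +
    \sum_(j < njobs I) weight j * job_time (energy S') j) <= (1 + eps / 2) * cost S'.
  by rewrite ler_wpM2l.
rewrite mulr0; lra.
Qed.

End Relaxation.

(** * Existence of list schedules *)

(** There are finitely many possible values, and taking a given value is a finite intersection of
    measurable conditions. *)
Lemma measurable_finset_valued {R : realType} {n : nat} (A : R -> pred 'I_n)
    (P : pred {set 'I_n}) :
  (forall j, measurable ([set t | A t j]%classic : set (measurableTypeR R))) ->
  measurable ([set t | P (finset (A t))]%classic : set (measurableTypeR R)).
Proof.
move=> mA.
have -> : [set t | P (finset (A t))]%classic =
    (\bigcup_(B in [set B | P B])
      \bigcap_(j in setT) [set t | A t j = (j \in B)])%classic.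
  apply/seteqP; split=> t /=; first by exists (finset (A t)) => // j _ /=; rewrite inE.
  move=> [B PB tB]; rewrite (_ : finset (A t) = B)//.
  by apply/setP => j; rewrite inE; exact: tB.
apply: fin_bigcup_measurable; first exact: finite_finset.
move=> B _; apply: fin_bigcap_measurable; first exact: finite_finset.
move=> j _; case: (j \in B); first exact: mA.
rewrite (_ : mkset _ = ~` [set t | A t j])%classic.
  by apply: measurableC; exact: mA.
by apply/seteqP; split=> t /=; [move=> ->|move/negP/negbTE].
Qed.

Section ListScheduleExists.
Context {R : realType} {I : instance R} (s : relax_solution I).
Local Notation job := 'I_(njobs I).
Implicit Types (A : R -> pred job) (j k : job) (t u : R).
Hypothesis validI : valid_instance I.

Definition rank_at A t j : nat := #|[pred k | A t k && (s.2 k < s.2 j)%N]|.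

Definition machine_free A j : set (measurableTypeR R) :=
  [set u | release j <= u /\ (rank_at A u j < nmach I)%N]%classic.

Lemma measurable_rank_at {A} j (P : pred nat) :
  (forall j, measurable ([set t | A t j]%classic : set (measurableTypeR R))) ->
  measurable ([set t | P (rank_at A t j)]%classic : set (measurableTypeR R)).
Proof.
pose Q (B : {set job}) := P #|[pred k | (k \in B) && (s.2 k < s.2 j)%N]|.
move=> /(measurable_finset_valued _ Q).
rewrite (_ : mkset _ = [set t | P (rank_at A t j)]%classic)//.
apply/seteqP; split=> t; rewrite /= /Q /rank_at; congr (is_true (P _));
  by apply: eq_card => k; rewrite !inE.
Qed.

Lemma measurable_machine_free A j :
  (forall j, measurable ([set t | A t j]%classic : set (measurableTypeR R))) ->
  measurable (machine_free A j).
Proof.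
move=> mA; rewrite (_ : machine_free A j =
  (`[release j, +oo[ `&` [set u | (rank_at A u j < nmach I)%N])%classic).
  apply: measurableI; first exact: measurable_itv.
  exact: (measurable_rank_at j (fun r => r < nmach I)%N mA).
by apply/seteqP; split=> u; rewrite /machine_free/= in_itv/= andbT.
Qed.

Lemma nonneg_machine_free A j : nonneg_set (machine_free A j).
Proof. by move=> u [+ _]; apply: le_trans; exact: release_ge0. Qed.

(* The jobs are inserted in priority order: a job does not disturb the jobs of
   higher priority and takes the first job_time units of the time they leave. *)
Lemma availability_exists : exists A,
  (forall j, measurable ([set t | A t j]%classic : set (measurableTypeR R))) /\
  forall t j, A t j =
    (release j <= t) && (occ (machine_free A j) t < job_time s.1 j).
Proof.
suff ind p : exists A,
    (forall j, measurable ([set t | A t j]%classic : set (measurableTypeR R))) /\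
    forall t j, (s.2 j < p)%N -> A t j =
      (release j <= t) && (occ (machine_free A j) t < job_time s.1 j).
  have [A [mA AE]] := ind (njobs I); exists A; split=> // t j.
  exact/AE/ltn_ord.
elim: p => [|p [A [mA AE]]].
  exists (fun _ _ => false); split=> // j.
  by rewrite (_ : mkset _ = set0)//; apply/seteqP; split.
pose F t j := (release j <= t) && (occ (machine_free A j) t < job_time s.1 j).
pose A' : R -> pred job := fun t j => if s.2 j == p :> nat then F t j else A t j.
(* The rank of a job at position at most [p] depends only on positions before [p], where [A'] and
   [A] agree. *)
have freeE j : (s.2 j <= p)%N -> machine_free A' j = machine_free A j.
  move=> jp; rewrite /machine_free; congr mkset; apply/funext => u.
  congr (_ /\ is_true (_ < _)%N); apply: eq_card => k.
  rewrite !inE /A'; case: ltnP => kj; rewrite ?andbF// !andbT.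
  by rewrite ltn_eqF// (leq_trans kj).
exists A'; split=> [j|t j jp].
  rewrite /A'; case: (_ == _); last exact: mA.
  rewrite (_ : mkset _ = (`[release j, +oo[ `&`
      [set u | occ (machine_free A j) u < job_time s.1 j])%classic).
    apply: measurableI; first exact: measurable_itv.
    apply: measurable_occ_lt; first exact: measurable_machine_free.
    exact: nonneg_machine_free.
  by apply/seteqP; split=> u; rewrite /F/= in_itv/= andbT => /andP.
rewrite freeE// /A'; case: eqP => // /eqP jNp.
by rewrite AE// ltn_neqAle jNp.
Qed.

Lemma list_schedule_exists : exists S : schedule I, list_schedule s S.
Proof.
have [A [mA AE]] := availability_exists.
(* Machine [i] takes the available job of rank exactly [i]. Available jobs have distinct ranks, so
   the pick is determined, and a job has only one rank, so it runs on one machine. *)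
pose run_at (i : 'I_(nmach I)) t := [pick j | A t j && (rank_at A t j == i)].
have rank_inj t j k : A t j -> A t k -> rank_at A t j = rank_at A t k -> j = k.
  move=> Aj Ak; wlog jk : j k Aj Ak / (s.2 j < s.2 k)%N => [H|].
    case: (ltngtP (s.2 j) (s.2 k)) => [||/val_inj/perm_inj//]; first exact: H.
    by move=> kj /esym; move/(H _ _ Ak Aj kj).
  move=> rE; suff : (rank_at A t j < rank_at A t k)%N by rewrite rE ltnn.
  apply/proper_card/properP; split; last first.
    by exists j; rewrite !inE ?Aj ?jk// ltnn.
  apply/fintype.subsetP => l; rewrite !inE => /andP[-> /= lj].
  exact: ltn_trans jk.
have runE i t j : (run_at i t == Some j) = A t j && (rank_at A t j == i).
  rewrite /run_at; case: pickP => [k /andP[Ak /eqP ki]|none]; last exact/esym/none.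
  apply/eqP/andP => [[<-]|[Aj /eqP ji]]; first by rewrite Ak ki.
  by congr Some; apply: rank_inj Ak Aj _; rewrite ki ji.
have run_meas i j :
    measurable ([set t | run_at i t = Some j]%classic : set (measurableTypeR R)).
  rewrite (_ : mkset _ = [set t | A t j] `&` [set t | rank_at A t j == i])%classic.
    apply: measurableI; first exact: mA.
    exact: (measurable_rank_at j (fun r => r == i) mA).
  apply/seteqP; split=> t /=.
    by move=> /eqP; rewrite runE => /andP.
  by move=> /andP; rewrite -runE => /eqP.
have run_uniq t i i' j : run_at i t = Some j -> run_at i' t = Some j -> i = i'.
  move=> /eqP + /eqP; rewrite !runE => /andP[_ /eqP ij] /andP[_ /eqP].
  by rewrite ij => /val_inj.
pose S := Schedule s.1 run_meas run_uniq.
have runningE t j : running S t j = A t j && (rank_at A t j < nmach I)%N.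
  apply/existsP/andP => [[i]|[Aj jm]].
    by rewrite runE => /andP[-> /eqP ->]; rewrite ltn_ord.
  by exists (Ordinal jm); rewrite runE Aj /=.
have runsetE j : runset S j = [set u | machine_free A j u /\
    occ (machine_free A j) u < job_time s.1 j]%classic.
  apply/seteqP; split=> u; rewrite /runset/= runningE AE.
    by move=> /andP[/andP[]].
  by move=> [[-> ->] ->].
(* Processing is the free time truncated at the demand of the job, so [occ_truncate] identifies true
   availability with [A]. *)
have availE t j : available S t j = A t j.
  rewrite AE /available processedE runsetE; congr (_ && _).
  apply: occ_truncate; first exact: measurable_machine_free.
    exact: nonneg_machine_free.
  by rewrite -runsetE; exact: measurable_runset.
exists S; split=> // t j; rewrite runningE availE; congr (_ && (_ < _)%N).
by apply: eq_card => k; rewrite !inE availE.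
Qed.

End ListScheduleExists.

(** * Existence of an output and the approximation ratio *)

Lemma output_exists {R : realType} {I : instance R} {eps : R}
    {solve : R -> option (relax_solution I)} :
  valid_instance I -> 0 < eps -> relax_approx (1 + eps / 2) solve ->
  exists S : schedule I, fast_relax_list eps solve S.
Proof.
move=> validI eps0 solveP.
have e0 : 0 < eps / 2 by rewrite divr_gt0.
have /choice[sched schedP] : forall s : relax_solution I, exists S, list_schedule s S.
  by move=> s; exact: list_schedule_exists.
pose found i := omap sched (solve (guess I (eps / 2) i)).
have [i0 [i0l Ui0 _]] : exists i : nat, [/\ i%:Z <= last_guess I (eps / 2),
    X_U I <= guess I (eps / 2) i & guess I (eps / 2) i <= (1 + eps / 2) * X_U I].
  by apply: guess_cover => //; rewrite X_L_le_X_U// lexx.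
(* A guess of at least [X_U] admits the proportional energies, so [None] is excluded there. *)
have [s0 solve0] : exists s, solve (guess I (eps / 2) i0) = Some s.
  have := solveP (guess I (eps / 2) i0).
  case: (solve _) => [s _|noSol]; first by exists s.
  exfalso; apply: (noSol (uniform_energy, 1%g)); apply/relax_feasibleE => //.
  split; first exact: uniform_energy_assignment.
  exact: le_trans (uniform_weighted_time_le validI) Ui0.
pose N := `|last_guess I (eps / 2)|%N.
have leN (i : nat) : i%:Z <= last_guess I (eps / 2) -> (i < N.+1)%N.
  by move=> il; rewrite ltnS -lez_nat /N gez0_abs// (le_trans _ il).
have NE : N%:Z = last_guess I (eps / 2) by rewrite /N gez0_abs// (le_trans _ i0l).
pose P (i : 'I_N.+1) := isSome (found i).
(* The default 0 never enters: the minimum is taken over indices satisfying [P]. *)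
pose c (i : 'I_N.+1) := oapp (@cost R I) 0 (found i).
have P0 : P (Ordinal (leN _ i0l)) by rewrite /P /found/= solve0.
have [i Pi imin] := arg_minP c P0.
move: Pi; rewrite /P; case foundi : (found i) => [S|//] _.
exists S, found; split.
- move=> k _; rewrite /found; case: (solve _) => //= s.
  by exists (sched s).
- by exists (i : nat) => //; rewrite -NE lez_nat -ltnS.
- move=> k Sk kl foundk; have := imin (Ordinal (leN _ kl)).
  by rewrite /P /c /= foundk foundi; exact.
Qed.

Theorem theorem8 (R : realType) (I : instance R) (eps : R)
    (solve : R -> option (relax_solution I)) :
  valid_instance I -> 0 < eps ->
  relax_approx (1 + eps / 2) solve ->
  (exists S : schedule I, fast_relax_list eps solve S) /\
  (forall S : schedule I, fast_relax_list eps solve S ->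
     feasible S /\ cost S <= (2 + eps) * opt I).
Proof.
move=> validI eps0 solveP; split; first exact: output_exists.
move=> S outS; have fS := output_feasible validI solveP outS; split=> //.
have e2 : 0 < 2 + eps by rewrite addr_gt0.
(* [opt] is an infimum; its set is nonempty because it contains the cost of the output itself. *)
rewrite mulrC -ler_pdivrMr//; apply: lb_le_inf; first by exists (cost S), S.
move=> _ [S' fS' <-]; rewrite ler_pdivrMr// mulrC.
exact: output_cost_le outS fS'.
Qed.
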